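(* Let $\phi=(f,g)\in\mathrm{Hom}_{\mathrm{Bmod}^2}(M,N)$. The following conditions are equivalent: 1. $B(f,g)=N\times N$. 2. The sequence $M\underset{g}{\overset{f}{\rightrightarrows}}N\underset{0}{\overset{0}{\rightrightarrows}}0$ is strictly exact at $N$. 3. The morphism $\phi$ is an epimorphism in the category $\mathrm{Bmod}^2$.
   Context: $\mathbb B=\{0,1\}$ is the Boolean semifield ($1+1=1$). A $\mathbb B$-module is a commutative monoid $(M,+,0)$ with $x+x=x$ for all $x$; morphisms are the monoid homomorphisms, added pointwise; the category is $\mathrm{Bmod}$. $\mathrm{Bmod}^2$ has $\mathbb B$-modules as objects, and morphisms $M\to N$ are pairs $(f,g)$ of morphisms in $\mathrm{Bmod}$, composed by $(f,g)\circ(f',g')=(f f'+g g',\,f g'+g f')$. For $\alpha_1,\alpha_2:L\to M$ and $\beta_1,\beta_2:M\to N$ put $B(\alpha_1,\alpha_2)=\{(\alpha_1(x)+\alpha_2(y),\alpha_2(x)+\alpha_1(y))\mid x,y\in L\}\subset M\times M$, $Z(\beta_1,\beta_2)=\{(u,v)\in M\times M\mid\beta_1(u)+\beta_2(v)=\beta_2(u)+\beta_1(v)\}$, and let $\Delta\subset M\times M$ be the diagonal. The sequence $L\underset{\alpha_2}{\overset{\alpha_1}{\rightrightarrows}}M\underset{\beta_2}{\overset{\beta_1}{\rightrightarrows}}N$ is strictly exact at $M$ if $B(\alpha_1,\alpha_2)+\Delta=Z(\beta_1,\beta_2)$. *)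

(* Defs.v *)
From HB Require Import structures.
From mathcomp Require Import all_boot all_order all_algebra.
From mathcomp Require Import boolp classical_sets.

Set Implicit Arguments.
Unset Strict Implicit.
Unset Printing Implicit Defensive.

Import GRing.Theory.

Local Open Scope classical_set_scope.
Local Open Scope ring_scope.

(* A module over the Boolean semifield is a commutative monoid with idempotent
   addition (x + x = (1 + 1) x = x); its morphisms are [{additive M -> N}]. *)
HB.mixin Record Nmodule_isBmodule V of GRing.Nmodule V := {
  addbmm : idempotent_op (+%R : V -> V -> V)
}.

#[short(type="bmodType")]
HB.structure Definition Bmodule :=
  {V of GRing.Nmodule V & Nmodule_isBmodule V}.

(* The zero module is carried by [unit]. *)
Definition addtt (_ _ : unit) : unit := tt.

Fact addttA : associative addtt. Proof. by []. Qed.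
Fact addttC : commutative addtt. Proof. by []. Qed.
Fact add0tt : left_id tt addtt. Proof. by case. Qed.

HB.instance Definition _ := GRing.isNmodule.Build unit addttA addttC add0tt.

Fact addttm : idempotent_op (+%R : unit -> unit -> unit). Proof. by case. Qed.

HB.instance Definition _ := Nmodule_isBmodule.Build unit addttm.

Definition bmod2_hom (M N : bmodType) : Type :=
  {additive M -> N} * {additive M -> N}.

Definition bmod2_comp (L M N : bmodType)
    (phi : bmod2_hom M N) (psi : bmod2_hom L M) : bmod2_hom L N :=
  ( (phi.1 \o psi.1) \+ (phi.2 \o psi.2) : {additive L -> N},
    (phi.1 \o psi.2) \+ (phi.2 \o psi.1) : {additive L -> N} ).

Definition bmod2_epi (M N : bmodType) (phi : bmod2_hom M N) : Prop :=
  forall (P : bmodType) (psi psi' : bmod2_hom N P),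
    bmod2_comp psi phi = bmod2_comp psi' phi -> psi = psi'.

Definition Bset (L M : bmodType) (a1 a2 : {additive L -> M}) : set (M * M) :=
  [set (a1 x + a2 y, a2 x + a1 y) | x in [set: L] & y in [set: L]].

Definition Zset (M N : bmodType) (b1 b2 : {additive M -> N}) : set (M * M) :=
  [set p | b1 p.1 + b2 p.2 = b2 p.1 + b1 p.2].

Definition strictly_exact (L M N : bmodType)
    (a1 a2 : {additive L -> M}) (b1 b2 : {additive M -> N}) : Prop :=
  [set p + q | p in Bset a1 a2 & q in diagonal] = Zset b1 b2.

Definition bmod0 (N : bmodType) : {additive N -> unit} := \0.

(* Main.v *)
(** An epimorphism of idempotent commutative monoids is surjective: a point [e]
    outside a submonoid [B] is separated from [B] by the two maps to the Boolean
    semifield whose kernels are [{x | x <= e}] and [{x | x <= b <= e, b in B}],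
    where [x <= y] means [x + y = y]; they agree on [B] but not at [e]. Since a
    pair [(a, b)] of morphisms [N -> P] amounts to a single morphism
    [N * N -> P], an epimorphism [(f, g)] of Bmod^2 is an epimorphism
    [M * M -> N * N] of Bmod, and the image of the latter is [Bset f g]. *)
Require Import Defs.
From HB Require Import structures.
From mathcomp Require Import all_boot all_order all_algebra.
From mathcomp Require Import boolp classical_sets.

Import GRing.Theory.
Local Open Scope ring_scope.

(** [bmod2_epi] compares morphisms by Leibniz equality, so the records must coincide: function
    extensionality identifies the maps, proof irrelevance their additivity. *)
Lemma additive_ext (M N : nmodType) (a b : {additive M -> N}) :
  a =1 b -> a = b.
Proof.
case: a => a [[ca]]; case: b => b [[cb]] /= /funext ab.
by case: _ / ab in cb *; rewrite (Prop_irrelevance ca cb).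
Qed.

Section Pairs.
Variables V W : nmodType.

Definition inl_pair (x : V) : V * W := (x, 0).
Definition inr_pair (y : W) : V * W := (0, y).

Fact inl_pair_nmod_morphism : nmod_morphism inl_pair.
Proof. by split=> // x y; rewrite [RHS]/GRing.add /= /add_pair /= addr0. Qed.

Fact inr_pair_nmod_morphism : nmod_morphism inr_pair.
Proof. by split=> // x y; rewrite [RHS]/GRing.add /= /add_pair /= addr0. Qed.

HB.instance Definition _ :=
  GRing.isNmodMorphism.Build V (V * W)%type inl_pair inl_pair_nmod_morphism.
HB.instance Definition _ :=
  GRing.isNmodMorphism.Build W (V * W)%type inr_pair inr_pair_nmod_morphism.

Lemma pair_split (p : V * W) : p = inl_pair p.1 + inr_pair p.2.
Proof.
by case: p => x y; rewrite [RHS]/GRing.add /= /add_pair /= addr0 add0r.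
Qed.

End Pairs.

Fact pair_addbmm (V W : bmodType) : idempotent_op (+%R : V * W -> _ -> _).
Proof. by case=> x y; congr pair; exact: addbmm. Qed.

HB.instance Definition _ (V W : bmodType) :=
  Nmodule_isBmodule.Build (V * W)%type (pair_addbmm V W).

(* An alias, because [bool] is already an additive group for [addb]. *)
Definition boole : Type := bool.
HB.instance Definition _ := Choice.on boole.
HB.instance Definition _ := GRing.isNmodule.Build boole orbA orbC orFb.
HB.instance Definition _ := Nmodule_isBmodule.Build boole orbb.

Section Characters.
Variables (V : nmodType) (I : set V).
Hypotheses (I0 : I 0) (ID : forall x y, I (x + y) <-> I x /\ I y).

Let char_fun (x : V) : boole := ~~ `[< I x >].

(** Complementing [ID]: a sum lies outside [I] exactly when one of its summands does, and
    disjunction is the addition of [boole]. *)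
Fact character_nmod_morphism : nmod_morphism char_fun.
Proof.
split=> [|x y]; first by rewrite /char_fun asboolT.
rewrite /char_fun [RHS]/GRing.add /= -negb_and -asbool_and; congr (~~ _).
exact: asbool_equiv_eq.
Qed.

Definition character : {additive V -> boole} :=
  HB.pack char_fun
    (GRing.isNmodMorphism.Build V boole char_fun character_nmod_morphism).

Lemma characterE x : character x = ~~ `[< I x >].
Proof. by []. Qed.

End Characters.

(** The sum is the join for the order [x + y = y]; this provides the hypothesis [ID] for
    down-sets. *)
Lemma addbm_eqr (V : bmodType) (x y z : V) :
  x + y + z = z <-> x + z = z /\ y + z = z.
Proof.
split=> [xyz | [xz yz]]; last by rewrite -addrA yz.
have idx := addbmm x; have idy := addbmm y.
split; rewrite -[in LHS]xyz; first by rewrite !addrA idx.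
by rewrite (addrC x y) !addrA idy (addrC y x).
Qed.

Lemma submonoid_separation (E : bmodType) (B : set E) :
    B 0 -> (forall x y, B x -> B y -> B (x + y)) ->
    (forall a b : {additive E -> boole},
       (forall x, B x -> a x = b x) -> a =1 b) ->
  B = [set: E]%classic.
Proof.
move=> B0 BD sepB; apply/predeqP => e; split=> // _.
pose I x := x + e = e.
pose J x := exists b, [/\ B b, x + b = b & b + e = e].
have I0 : I 0 by exact: add0r.
have ID x y : I (x + y) <-> I x /\ I y by exact: addbm_eqr.
have J0 : J 0 by exists 0; rewrite !add0r.
have JD x y : J (x + y) <-> J x /\ J y.
  split=> [[b [Bb /addbm_eqr[xb yb] be]] | [[b [Bb xb be]] [c [Bc yc ce]]]].
    by split; exists b.
  exists (b + c); split; [exact: BD | | by apply/addbm_eqr].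
  by rewrite addrACA xb yc.
have IJ x : B x -> character E I I0 ID x = character E J J0 JD x.
  move=> Bx; rewrite !characterE; congr (~~ _); apply: asbool_equiv_eq.
  (* An element of [B] below [e] is its own witness [b]. *)
  split=> [xe | [b [_ xb be]]]; first by exists x; rewrite addbmm.
  by rewrite /I -be addrA xb.
(* Since [e] is in [I], it is in [J]: some [b] in [B] satisfies [e <= b <= e], so [e = b] by
   antisymmetry. *)
have := sepB _ _ IJ e; rewrite !characterE asboolT; last exact: addbmm.
by move/esym/negbFE/asboolP => [b [Bb eb be]]; rewrite -be addrC eb.
Qed.

Lemma Bset0 (L M : bmodType) (f g : {additive L -> M}) : Bset f g 0.
Proof. by exists 0 => //; exists 0 => //; rewrite !raddf0 addr0. Qed.

Lemma BsetD (L M : bmodType) (f g : {additive L -> M}) p q :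
  Bset f g p -> Bset f g q -> Bset f g (p + q).
Proof.
move=> [x _ [y _ <-]] [x' _ [y' _ <-]].
exists (x + x') => //; exists (y + y') => //.
by rewrite !raddfD; congr pair; rewrite addrACA.
Qed.

(** With zero target [Zset] is everything, so exactness writes every pair as a member of [Bset f g]
    plus a diagonal one. It is enough to reach [(u, 0)] and [(0, v)]. *)
Lemma strictly_exact0_Bset (M N : bmodType) (f g : {additive M -> N}) :
  strictly_exact f g (bmod0 N) (bmod0 N) -> Bset f g = [set: N * N]%classic.
Proof.
move=> exact_fg; apply/predeqP => -[u v]; split=> // _.
have mem p : exists2 b, Bset f g b & exists d, b + (d, d) = p.
  have : Zset (bmod0 N) (bmod0 N) p by [].
  rewrite -exact_fg => -[b Bb [[d d'] + <-]]; rewrite /diagonal /= => dd.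
  by exists b; [|exists d; rewrite -dd].
(* [x + d = 0] forces [d = 0], so pairs with a zero entry need no diagonal. *)
have zero (x d : N) : x + d = 0 -> d = 0.
  move=> xd; have dd := addbmm d; rewrite /= in dd.
  by rewrite -[LHS]add0r -xd -addrA dd.
rewrite [(u, v)]pair_split; apply: BsetD.
- have [b Bb [d eq_u]] := mem (u, 0); move: (congr1 snd eq_u) => /zero /= d0.
  by rewrite /inl_pair -eq_u d0 [b + _]addr0.
- have [b Bb [d eq_v]] := mem (0, v); move: (congr1 fst eq_v) => /zero /= d0.
  by rewrite /inr_pair -eq_v d0 [b + _]addr0.
Qed.

Lemma bmod2_epi_Bset (M N : bmodType) (f g : {additive M -> N}) :
  bmod2_epi ((f, g) : bmod2_hom M N) -> Bset f g = [set: N * N]%classic.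
Proof.
move=> epi; apply: submonoid_separation; [exact: Bset0 | exact: BsetD |].
move=> a b ab p.
pose restr (c : {additive N * N -> boole}) : bmod2_hom N boole :=
  (c \o inl_pair N N : {additive N -> boole},
   c \o inr_pair N N : {additive N -> boole}).
have restrE (c : {additive N * N -> boole}) q :
    c q = (restr c).1 q.1 + (restr c).2 q.2.
  by rewrite [in LHS](pair_split _ _ q) raddfD.
suff eq_restr : restr a = restr b by rewrite !restrE eq_restr.
(* The components of the composite at [x] are the values at [(f x, g x)] and [(g x, f x)], which
   both lie in [Bset f g]. *)
apply: epi; congr pair; apply: additive_ext => x /=.
  rewrite -(restrE a (f x, g x)) -(restrE b (f x, g x)); apply: ab.
  by exists x => //; exists 0 => //; rewrite !raddf0 !addr0.
rewrite -(restrE a (g x, f x)) -(restrE b (g x, f x)); apply: ab.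
by exists 0 => //; exists x => //; rewrite !raddf0 !add0r.
Qed.

(** Equal composites make the two maps [a u + b v] and [a' u + b' v] agree on the generators
    [(f x, g x)] and [(g x, f x)] of [Bset f g], hence everywhere; the two axes then recover the
    components. *)
Lemma Bset_bmod2_epi (M N : bmodType) (f g : {additive M -> N}) :
  Bset f g = [set: N * N]%classic -> bmod2_epi ((f, g) : bmod2_hom M N).
Proof.
move=> BT P [a b] [a' b'] eq_comp.
have e1 x : a (f x) + b (g x) = a' (f x) + b' (g x).
  by have := congr1 (fun h : bmod2_hom M P => h.1 x) eq_comp.
have e2 x : a (g x) + b (f x) = a' (g x) + b' (f x).
  by have := congr1 (fun h : bmod2_hom M P => h.2 x) eq_comp.
have eqB u v : a u + b v = a' u + b' v.
  have : Bset f g (u, v) by rewrite BT.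
  by move=> [x _ [y _ [<- <-]]]; rewrite !raddfD addrACA e1 e2 addrACA.
congr pair; apply: additive_ext => x.
  by have := eqB x 0; rewrite !raddf0 !addr0.
by have := eqB 0 x; rewrite !raddf0 !add0r.
Qed.

Theorem proposition4p13 (M N : bmodType) (f g : {additive M -> N}) :
  [<-> Bset f g = [set: N * N]%classic;
       strictly_exact f g (bmod0 N) (bmod0 N);
       bmod2_epi ((f, g) : bmod2_hom M N)].
Proof.
tfae.
- move=> BT; rewrite /strictly_exact BT; apply/predeqP => p; split=> // _.
  by exists p => //; exists 0; rewrite ?addr0.
- by move/strictly_exact0_Bset/Bset_bmod2_epi.
- exact: bmod2_epi_Bset.
Qed.
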